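(* Let $A_j$ be invertible. Assume that $\tilde T_{jk}$ is the measured time of arrival with perturbations, and that $\tilde a(t_j)$ and $\tilde t_j$ are the locations and emission moments of the point source calculated from the perturbed data. Suppose there exists a uniform constant $M>0$ such that $\|\delta A\|:=\|\tilde A_j-A_j\|\le Mc^2\delta$ and $\|\delta b\|:=\|\tilde b_j-b_j\|\le Mc^2\epsilon$ for $j=1,\dots,J$. Then the following estimate holds: $$\|\tilde X_j-X_j\|\le \frac{Mc^2\big(\epsilon+\|A_j^{-1}\|\,\|b_j\|\,\delta\big)}{\|A_j^{-1}\|^{-1}-Mc^2\delta},\qquad j=1,2,\dots,J.$$
   Context: Setting: $c>0$ is the constant wave speed in $\mathbb{R}^3$. A moving point source follows a continuous trajectory $a(t)\in\mathbb{R}^3$, $t\in[t_{\min},t_{\max}]$, $0<t_{\min}<t_{\max}$, with $|a'(t)|<c$ for all $t$, and emits pulses at moments $t_{\min}\le t_1<\dots<t_J\le t_{\max}$. There are five observation points $x_1,\dots,x_5\in\mathbb{R}^3$, not on the trajectory, with $x_1=0$ without loss of generality. The times of arrival are $T_{jk}=t_j+c^{-1}|x_k-a(t_j)|$, $j=1,\dots,J$, $k=1,\dots,5$. For each $j$, $A_j$ is the $4\times4$ matrix whose $(k-1)$-th row is $\big(x_k\;\;c^2(T_{j1}-T_{jk})\big)$, and $b_j\in\mathbb{R}^4$ has $(k-1)$-th entry $\frac{c^2}{2}(T_{j1}^2-T_{jk}^2)+\frac{|x_k|^2}{2}$, for $k=2,\dots,5$. The vector $X_j=(a(t_j)\;\;t_j)^{\top}$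 satisfies $A_jX_j=b_j$. The matrix $\tilde A_j$ and vector $\tilde b_j$ are built by the same formulas from the perturbed times $\tilde T_{jk}$, and $\tilde X_j=(\tilde a(t_j)\;\;\tilde t_j)^{\top}$ is the corresponding reconstruction, satisfying $\tilde A_j\tilde X_j=\tilde b_j$. The numbers $\delta$ and $\epsilon$ are the perturbation levels of the matrix and of the right-hand side appearing in the two assumed bounds. The norm $\|\cdot\|$ is the 2-norm.
   Formalization: The estimate for an index j is stated under the added condition that the denominator is positive, Mc²δ < ‖A_j⁻¹‖⁻¹; otherwise the right-hand side is undefined or negative and the bound fails. *)

(* Defs.v *)
From HB Require Import structures.
From mathcomp Require Import all_boot all_order all_algebra.
From mathcomp Require Import all_classical all_reals all_analysis.

Set Implicit Arguments.
Unset Strict Implicit.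
Unset Printing Implicit Defensive.

Import Order.TTheory GRing.Theory Num.Theory numFieldNormedType.Exports.

Local Open Scope classical_set_scope.
Local Open Scope ring_scope.

(* The library norm `|v| on matrices is the sup norm; the 2-norm and the
   operator norm it induces are therefore defined here. *)
Definition norm2 (R : realType) (n : nat) (v : 'cV[R]_n) : R :=
  Num.sqrt (\sum_(i < n) v i 0 ^+ 2).

Definition mxnorm2 (R : realType) (m n : nat) (A : 'M[R]_(m, n)) : R :=
  sup [set norm2 (A *m v) | v in [set v : 'cV[R]_n | norm2 v <= 1]].

(* Derivative relative to a set I: two-sided at the interior points of an
   interval I, one-sided at its endpoints. *)
Definition is_derive_within (R : realType) (V : normedModType R)
    (I : set R) (f : R -> V) (s : R) (df : V) : Prop :=
  (r - s)^-1 *: (f r - f s) @[r --> within I s^'] --> df.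

(* T = s + c^-1 |x - p|, for a pulse emitted from p at time s, observed at x. *)
Definition arrival_time (R : realType) (c : R) (p : 'cV[R]_3) (s : R)
    (x : 'cV[R]_3) : R :=
  s + c^-1 * norm2 (x - p).

(* Index 0 of 'I_5 is the reference point x_1; row k of the system compares it
   with the observation point of index lift ord0 k, i.e. k + 1. *)
Definition source_mx (R : realType) (c : R) (x : 'I_5 -> 'cV[R]_3)
    (T : 'I_5 -> R) : 'M[R]_4 :=
  row_mx (\matrix_(k < 4) (x (lift ord0 k))^T)
         (\col_(k < 4) (c ^+ 2 * (T ord0 - T (lift ord0 k)))).

Definition source_rhs (R : realType) (c : R) (x : 'I_5 -> 'cV[R]_3)
    (T : 'I_5 -> R) : 'cV[R]_4 :=
  \col_(k < 4) (c ^+ 2 / 2 * (T ord0 ^+ 2 - T (lift ord0 k) ^+ 2)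
                + norm2 (x (lift ord0 k)) ^+ 2 / 2).

Definition source_vec (R : realType) (p : 'cV[R]_3) (s : R) : 'cV[R]_4 :=
  col_mx p (s%:M : 'M[R]_1).

(* Main.v *)
Require Import Defs.
From HB Require Import structures.
From mathcomp Require Import all_boot all_order all_algebra.
From mathcomp Require Import all_classical all_reals all_analysis.
From mathcomp Require Import ring lra.

Set Implicit Arguments.
Unset Strict Implicit.
Unset Printing Implicit Defensive.

Import Order.TTheory GRing.Theory Num.Theory numFieldNormedType.Exports.

Local Open Scope classical_set_scope.
Local Open Scope ring_scope.

(** The exact pair [X] = (position, emission time) solves [A X = b] because each
    arrival time expresses a sphere equation |x_k - p|^2 = c^2 (T_k - s)^2, and
    subtracting the one centred at the origin cancels the terms in |p|^2 and
    s^2 that are quadratic in the unknowns ([source_system]).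

    The estimate is then the classical perturbation bound for linear systems
    ([linear_system_perturbation]).  With [d = Xp - X], subtracting the two systems gives
    [A d = (bp - b) - (Ap - A) (X + d)]; applying the inverse of [A], of norm
    N, and using |X| <= N |b|,
      |d| <= N (Mc^2 epsilon + Mc^2 delta (N |b| + |d|)).
    Dividing by N and moving the term in |d| to the left-hand side yields
    the claim; N is nonzero because its inverse exceeds Mc^2 delta, which is at
    least the norm of [Ap - A] and hence nonnegative.  The triangle inequality
    and |A v| <= |A| |v| both rest on the Cauchy-Schwarz inequality, the second
    because the supremum that defines the operator norm has to be finite. *)

Section Euclidean_norm.
Variable R : realType.

Lemma norm2_ge0 n (v : 'cV[R]_n) : 0 <= norm2 v.
Proof. exact: sqrtr_ge0. Qed.

Lemma norm2_sqr n (v : 'cV[R]_n) : norm2 v ^+ 2 = \sum_i v i 0 ^+ 2.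
Proof. by rewrite sqr_sqrtr // sumr_ge0 // => i _; exact: sqr_ge0. Qed.

Lemma norm2_0 n : norm2 (0 : 'cV[R]_n) = 0.
Proof. by rewrite /norm2 big1 ?sqrtr0 // => i _; rewrite mxE expr0n. Qed.

Lemma norm2_eq0 n (v : 'cV[R]_n) : norm2 v = 0 -> v = 0.
Proof.
move=> v0; apply/colP => i; rewrite mxE; apply/eqP.
have /eqP : \sum_i v i 0 ^+ 2 = 0 by rewrite -norm2_sqr v0 expr0n.
rewrite psumr_eq0 => [/allP/(_ i)|k _]; last exact: sqr_ge0.
by rewrite mem_index_enum sqrf_eq0 => /(_ isT).
Qed.

Lemma norm2Z n (k : R) (v : 'cV[R]_n) : norm2 (k *: v) = `|k| * norm2 v.
Proof.
rewrite /norm2 -sqrtr_sqr -sqrtrM ?sqr_ge0 // mulr_sumr.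
by congr Num.sqrt; apply: eq_bigr => i _; rewrite mxE exprMn.
Qed.

Lemma norm2N n (v : 'cV[R]_n) : norm2 (- v) = norm2 v.
Proof. by rewrite -scaleN1r norm2Z normrN1 mul1r. Qed.

(** Cauchy-Schwarz, by Lagrange's identity: twice the difference of the two
    sides is the sum over (i, j) of the squares (f i * g j - f j * g i)^2. *)
Lemma cauchy_schwarz_sum n (f g : 'I_n -> R) :
  (\sum_i f i * g i) ^+ 2 <= (\sum_i f i ^+ 2) * (\sum_i g i ^+ 2).
Proof.
have : 0 <= \sum_i \sum_j (f i * g j - f j * g i) ^+ 2.
  by apply: sumr_ge0 => i _; apply: sumr_ge0 => j _; exact: sqr_ge0.
suff -> : \sum_i \sum_j (f i * g j - f j * g i) ^+ 2 =
    2 * ((\sum_i f i ^+ 2) * (\sum_i g i ^+ 2)) -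
    2 * (\sum_i f i * g i) ^+ 2 by lra.
transitivity (\sum_i \sum_j f i ^+ 2 * g j ^+ 2 +
    \sum_i \sum_j g i ^+ 2 * f j ^+ 2 -
    2 * \sum_i \sum_j (f i * g i) * (f j * g j)).
  rewrite mulr_sumr -big_split -sumrB /=; apply: eq_bigr => i _.
  rewrite mulr_sumr -big_split -sumrB /=; apply: eq_bigr => j _; ring.
rewrite -!big_distrlr /=; ring.
Qed.

Lemma norm2D n (u v : 'cV[R]_n) : norm2 (u + v) <= norm2 u + norm2 v.
Proof.
rewrite -ler_sqr ?nnegrE ?addr_ge0 ?norm2_ge0 // [leRHS]sqrrD !norm2_sqr.
have -> : \sum_i (u + v) i 0 ^+ 2 =
    \sum_i u i 0 ^+ 2 + (\sum_i u i 0 * v i 0) *+ 2 + \sum_i v i 0 ^+ 2.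
  rewrite -sumrMnl -!big_split /=; apply: eq_bigr => i _.
  by rewrite mxE sqrrD.
rewrite lerD2r lerD2l lerMn2r /= (le_trans (ler_norm _)) //.
rewrite -ler_sqr ?nnegrE ?mulr_ge0 ?norm2_ge0 //.
by rewrite real_normK ?num_real // exprMn !norm2_sqr cauchy_schwarz_sum.
Qed.

(** The bound by the Frobenius norm is what makes the supremum defining
    [mxnorm2] finite. *)
Lemma norm2_mulmx_frobenius m n (A : 'M[R]_(m, n)) (v : 'cV[R]_n) :
  norm2 (A *m v) <= Num.sqrt (\sum_i \sum_j A i j ^+ 2) * norm2 v.
Proof.
have F0 : 0 <= \sum_i \sum_j A i j ^+ 2.
  by apply: sumr_ge0 => i _; apply: sumr_ge0 => j _; exact: sqr_ge0.
rewrite -ler_sqr ?nnegrE ?mulr_ge0 ?sqrtr_ge0 ?norm2_ge0 //.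
rewrite exprMn !norm2_sqr sqr_sqrtr // mulr_suml; apply: ler_sum => i _.
by rewrite mxE cauchy_schwarz_sum.
Qed.

Lemma mxnorm2_has_sup m n (A : 'M[R]_(m, n)) :
  has_sup [set norm2 (A *m v) | v in [set v : 'cV[R]_n | norm2 v <= 1]].
Proof.
split.
  by exists (norm2 (A *m 0)), 0 => //=; rewrite norm2_0.
exists (Num.sqrt (\sum_i \sum_j A i j ^+ 2)) => _ [v /= v1 <-].
by rewrite (le_trans (norm2_mulmx_frobenius A v)) // ler_piMr ?sqrtr_ge0.
Qed.

Lemma norm2_mulmx_ball m n (A : 'M[R]_(m, n)) (v : 'cV[R]_n) :
  norm2 v <= 1 -> norm2 (A *m v) <= mxnorm2 A.
Proof.
by move=> v1; apply: (ub_le_sup (mxnorm2_has_sup A).2); exists v.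
Qed.

Lemma mxnorm2_ge0 m n (A : 'M[R]_(m, n)) : 0 <= mxnorm2 A.
Proof.
by rewrite (le_trans (norm2_ge0 (A *m 0))) // norm2_mulmx_ball // norm2_0.
Qed.

Lemma norm2_mulmx m n (A : 'M[R]_(m, n)) (v : 'cV[R]_n) :
  norm2 (A *m v) <= mxnorm2 A * norm2 v.
Proof.
have [/norm2_eq0 ->|v0] := eqVneq (norm2 v) 0.
  by rewrite mulmx0 !norm2_0 mulr0.
have vp : 0 < norm2 v by rewrite lt_neqAle eq_sym v0 norm2_ge0.
rewrite -ler_pdivrMr // mulrC.
have /ger0_norm nV : 0 <= (norm2 v)^-1 by rewrite invr_ge0 norm2_ge0.
rewrite -{1}nV -norm2Z scalemxAr norm2_mulmx_ball //.
by rewrite norm2Z nV mulVf.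
Qed.

End Euclidean_norm.

(** The inverse of [A] is applied to
    [A (X' - X) = (b' - b) - (A' - A) (X + (X' - X))], so [X' - X] appears on
    both sides; the last hypothesis allows the right-hand occurrence to be
    absorbed. *)
Lemma linear_system_perturbation (R : realType) n (A A' : 'M[R]_n)
    (b b' X X' : 'cV[R]_n) (alpha beta : R) :
  A \in unitmx -> A *m X = b -> A' *m X' = b' ->
  mxnorm2 (A' - A) <= alpha -> norm2 (b' - b) <= beta ->
  0 < (mxnorm2 (invmx A))^-1 - alpha ->
  norm2 (X' - X) <= (beta + mxnorm2 (invmx A) * norm2 b * alpha) /
                    ((mxnorm2 (invmx A))^-1 - alpha).
Proof.
move=> Au AX AX' dA db den; set N := mxnorm2 (invmx A) in den *.
have alpha0 : 0 <= alpha := le_trans (mxnorm2_ge0 _) dA.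
(* Division by zero returns zero, so positivity of the inverse excludes N = 0. *)
have N0 : 0 < N by rewrite -invr_gt0; lra.
have Xle : norm2 X <= N * norm2 b.
  by rewrite -(mulKmx Au X) AX norm2_mulmx.
set d := X' - X.
have dE : d = invmx A *m ((b' - b) - (A' - A) *m (X + d)).
  rewrite -[LHS](mulKmx Au); congr (_ *m _).
  have -> : X + d = X' by rewrite addrC subrK.
  by rewrite mulmxBl mulmxBr AX AX' opprB [RHS]addrC addrA subrK.
rewrite ler_pdivlMr // mulrC mulrBl lerBlDr ler_pdivrMl //.
rewrite {1}dE (le_trans (norm2_mulmx _ _)) // ler_pM2l //.
rewrite (le_trans (norm2D _ _)) // norm2N -addrA lerD //.
rewrite (le_trans (norm2_mulmx _ _)) // mulrC [N * _ * _]mulrC -mulrDr mulrC.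
rewrite ler_pM ?mxnorm2_ge0 ?norm2_ge0 //.
by rewrite (le_trans (norm2D _ _)) // lerD2r.
Qed.

(** Half the difference of the sphere equations
    |x_k - p|^2 = c^2 (T_k - s)^2 and |p|^2 = c^2 (T_1 - s)^2. *)
Lemma source_system (R : realType) (c : R) (x : 'I_5 -> 'cV[R]_3)
    (p : 'cV[R]_3) (s : R) :
  c != 0 -> x ord0 = 0 ->
  source_mx c x (fun k => arrival_time c p s (x k)) *m source_vec p s =
  source_rhs c x (fun k => arrival_time c p s (x k)).
Proof.
move=> c0 x0; apply/colP => k.
rewrite /source_mx /source_vec.
rewrite (mul_row_col (\matrix_k (x (lift ord0 k))^T) _ p) mul_mx_scalar !mxE.
under eq_bigr do rewrite !mxE.
pose T l := arrival_time c p s (x l).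
have sphere l : norm2 (x l - p) ^+ 2 = c ^+ 2 * (T l - s) ^+ 2.
  by rewrite -exprMn /T /arrival_time; congr (_ ^+ 2); field.
have := sphere ord0; rewrite x0 sub0r norm2N.
have := sphere (lift ord0 k).
have -> : norm2 (x (lift ord0 k) - p) ^+ 2 = norm2 (x (lift ord0 k)) ^+ 2
    + norm2 p ^+ 2 - 2 * \sum_i x (lift ord0 k) i 0 * p i 0.
  rewrite !norm2_sqr mulr_sumr -big_split -sumrB /=.
  by apply: eq_bigr => i _; rewrite !mxE; ring.
rewrite -x0 -/(T ord0) -/(T (lift ord0 k)); lra.
Qed.

(* The positivity of the denominator is implicit in the estimate: without it
   the right-hand side can be negative and the bound fails. *)
Theorem theorem3p1 (R : realType) (c tmin tmax : R)
    (a da : R -> 'cV[R]_3) (J : nat) (t : 'I_J -> R) (x : 'I_5 -> 'cV[R]_3)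
    (Tp : 'I_J -> 'I_5 -> R) (ap : 'I_J -> 'cV[R]_3) (tp : 'I_J -> R)
    (M delta epsilon : R)
    (c_gt0 : 0 < c)
    (tmin_gt0 : 0 < tmin) (tmin_lt_tmax : tmin < tmax)
    (a_continuous : {within `[tmin, tmax], continuous a})
    (a_derive : forall s, s \in `[tmin, tmax] ->
       is_derive_within `[tmin, tmax] a s (da s))
    (a_subsonic : forall s, s \in `[tmin, tmax] -> norm2 (da s) < c)
    (t_range : forall j, t j \in `[tmin, tmax])
    (t_increasing : forall i j : 'I_J, (i < j)%N -> t i < t j)
    (x_off_trajectory : forall k s, s \in `[tmin, tmax] -> x k <> a s)
    (x1_eq0 : x ord0 = 0) :
  let A j := source_mx c x (fun k => arrival_time c (a (t j)) (t j) (x k)) in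
  let b j := source_rhs c x (fun k => arrival_time c (a (t j)) (t j) (x k)) in
  let X j := source_vec (a (t j)) (t j) in
  let Ap j := source_mx c x (Tp j) in
  let bp j := source_rhs c x (Tp j) in
  let Xp j := source_vec (ap j) (tp j) in
  (forall j, A j \in unitmx) ->
  (forall j, Ap j *m Xp j = bp j) ->
  0 < M ->
  (forall j, mxnorm2 (Ap j - A j) <= M * c ^+ 2 * delta) ->
  (forall j, norm2 (bp j - b j) <= M * c ^+ 2 * epsilon) ->
  forall j, 0 < (mxnorm2 (invmx (A j)))^-1 - M * c ^+ 2 * delta ->
    norm2 (Xp j - X j) <=
      M * c ^+ 2 * (epsilon + mxnorm2 (invmx (A j)) * norm2 (b j) * delta) /
      ((mxnorm2 (invmx (A j)))^-1 - M * c ^+ 2 * delta).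
Proof.
move=> A b X Ap bp Xp Au ApX M_gt0 dA db j den.
have AX : A j *m X j = b j by apply: source_system; rewrite ?gt_eqF.
have := linear_system_perturbation (Au j) AX (ApX j) (dA j) (db j) den.
by rewrite [_ * norm2 (b j) * (_ * delta)]mulrCA -mulrDr.
Qed.
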